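(* Let $\sigma>0$, $\Omega=[-1,1]^n$, $K(x,y)=e^{-\sigma^2\|x-y\|^2}$, and let $\{\lambda_i\}$ be the eigenvalues (nonincreasing, with multiplicity) of $T[\phi](x)=\int_\Omega K(x,y)\phi(y)\,dy$ on $L_2(\Omega)$ (Lebesgue measure). Then for every fixed $\theta\in(0,\frac12)$, $$\mathcal{E}(\varepsilon,\{\lambda_i\}_{i=1}^\infty)+m_{(1-\theta)\varepsilon}\ln\frac{3}{\theta}=O\Big(\frac{\ln^{n+1}(1/\varepsilon)}{(\ln\ln(1/\varepsilon))^n}\Big)\quad(\varepsilon\to0^+),$$ and consequently $\mathcal{H}(\varepsilon,B_{\mathcal{H}_K},C(\Omega))=O\Big(\frac{\ln^{n+1}(1/\varepsilon)}{(\ln\ln(1/\varepsilon))^n}\Big)$.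
   Context: $\mathcal{E}(\varepsilon,\{\lambda_i\}_{i=1}^\infty)=\sum_{i:\lambda_i>\varepsilon}\ln(\lambda_i/\varepsilon)$ and $m_\varepsilon=|\{i:\lambda_i>\varepsilon\}|$. $\mathcal{H}_K$ is the RKHS of $K$, $B_{\mathcal{H}_K}$ its open unit ball viewed in $C(\Omega)$ with sup norm, and $\mathcal{H}(\varepsilon,A,X)$ is the natural log of the minimal number of balls $c+\varepsilon B_X$, $c\in X$, covering $A$. *)

(* Defs.v *)
From HB Require Import structures.
From mathcomp Require Import all_boot all_order all_algebra.
From mathcomp Require Import all_classical all_reals all_analysis.
Set Implicit Arguments.
Unset Strict Implicit.
Unset Printing Implicit Defensive.
Import Order.TTheory GRing.Theory Num.Theory.
Import numFieldNormedType.Exports.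
Local Open Scope classical_set_scope.
Local Open Scope ring_scope.

Section Defs.
Variables (R : realType) (n : nat).
Local Notation pt := (n.-tuple R).

Definition cube : set pt := [set x | forall i : 'I_n, -1 <= tnth x i <= 1].

Definition sqdist (x y : pt) : R := \sum_(i < n) (tnth x i - tnth y i) ^+ 2.

Definition gaussK (sigma : R) (x y : pt) : R := expR (- (sigma ^+ 2 * sqdist x y)).

(* mu is n-dimensional Lebesgue measure (on the Borel sets of R^n = n.-tuple R):
   it gives every closed box its volume.  Such a measure exists and is unique. *)
Definition lebesgue_n (mu : {measure set pt -> \bar R}) : Prop :=
  forall a b : pt, (forall i, tnth a i <= tnth b i) ->
    mu [set x | forall i : 'I_n, tnth a i <= tnth x i <= tnth b i]
      = (\prod_(i < n) (tnth b i - tnth a i))%:E.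

Definition L2 (mu : {measure set pt -> \bar R}) (f : pt -> R) : Prop :=
  measurable_fun cube f /\
  (\int[mu]_(x in cube) ((f x) ^+ 2)%:E < +oo)%E.

(* lam is the sequence of eigenvalues, nonincreasing and repeated according to
   multiplicity, of the integral operator T[phi](x) = \int_Omega K(x,y) phi(y) dy
   on L_2(Omega): there is an orthonormal family of eigenfunctions phi_i with
   T phi_i = lam_i phi_i whose orthogonal complement is annihilated by T
   (spectral theorem for the compact self-adjoint operator T). *)
Definition eigenvalues_of_kernel (mu : {measure set pt -> \bar R})
    (K : pt -> pt -> R) (lam : nat -> R) : Prop :=
  {homo lam : i j / (i <= j)%N >-> j <= i} /\
  exists phi : nat -> pt -> R,
    [/\ forall i, measurable_fun cube (phi i),
        forall i j, (\int[mu]_(x in cube) (phi i x * phi j x)%:E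
                       = (if i == j then 1 else 0)%:E)%E,
        forall i, {ae mu, forall x, cube x ->
            (\int[mu]_(y in cube) (K x y * phi i y)%:E = (lam i * phi i x)%:E)%E} &
        forall f, L2 mu f ->
          (forall i, (\int[mu]_(x in cube) (f x * phi i x)%:E = 0)%E) ->
          {ae mu, forall x, cube x -> (\int[mu]_(y in cube) (K x y * f y)%:E = 0)%E}].

Definition eig_entropy (eps : R) (lam : nat -> R) : \bar R :=
  \esum_(i in [set i | eps < lam i]) (ln (lam i / eps))%:E.

Definition eig_count (eps : R) (lam : nat -> R) : \bar R :=
  \esum_(i in [set i | eps < lam i]) 1%E.

(* ---- the RKHS H_K and its open unit ball, following the Moore-Aronszajn
   construction: H_K is the completion of span{K(.,p) : p in Omega}, realized
   as functions on Omega. ---- *)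

Definition pre_eval (K : pt -> pt -> R) (s : seq (R * pt)) (x : pt) : R :=
  \sum_(c <- s) c.1 * K x c.2.

Definition pre_inner (K : pt -> pt -> R) (s t : seq (R * pt)) : R :=
  \sum_(c <- s) \sum_(d <- t) c.1 * d.1 * K c.2 d.2.

Definition pre_normsq_diff (K : pt -> pt -> R) (s t : seq (R * pt)) : R :=
  pre_inner K s s - 2 * pre_inner K s t + pre_inner K t t.

(* f belongs to the open unit ball of H_K: f is the pointwise limit on Omega of a
   Cauchy sequence (in the H_K norm) of finite combinations whose norms tend to a
   limit < 1. *)
Definition rkhs_open_ball (K : pt -> pt -> R) (f : pt -> R) : Prop :=
  exists s : nat -> seq (R * pt),
    [/\ forall k c, c \in s k -> cube c.2,
        forall e : R, 0 < e -> exists N, forall k l, (N <= k)%N -> (N <= l)%N ->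
            pre_normsq_diff K (s k) (s l) < e,
        forall x, cube x -> (fun k => pre_eval K (s k) x) @ \oo --> f x &
        exists2 r : R, r < 1 & exists N, forall k, (N <= k)%N ->
            pre_inner K (s k) (s k) <= r].

Definition cont_on_cube (c : pt -> R) : Prop :=
  forall x, cube x -> forall e : R, 0 < e -> exists2 d : R, 0 < d &
    forall y, cube y -> sqdist x y < d ^+ 2 -> `|c x - c y| < e.

Definition supdist (f g : pt -> R) : \bar R :=
  ereal_sup [set (`|f x - g x|)%:E | x in cube].

Definition covered_by (A : set (pt -> R)) (eps : R) (N : nat) : Prop :=
  exists c : 'I_N -> pt -> R,
    (forall j, cont_on_cube (c j)) /\
    forall f, A f -> exists j, (supdist f (c j) < eps%:E)%E.

Definition metric_entropy (A : set (pt -> R)) (eps : R) : \bar R :=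
  ereal_inf [set (ln N%:R)%:E | N in [set N | covered_by A eps N]].

End Defs.

Definition rate (R : realType) (n : nat) (eps : R) : R :=
  ln (eps^-1) ^+ n.+1 / ln (ln (eps^-1)) ^+ n.

(* Main.v *)
(** Expanding [exp (2 sigma^2 x_i y_i)] in each coordinate up to degree [D] writes
    the kernel as a sum of [D^n] products of features plus a positive semidefinite
    remainder of size [A e^(BZ) Z^(-D)], for every [Z >= 1].  With [L = ln (1/eps)],
    [Z = sqrt L] and [D ~ L / ln L], the remainder is at most [eps^2] up to a
    constant factor.

    Eigenvalues: some unit combination of [D^n + 1] eigenfunctions is orthogonal to
    all [D^n] features, and its Rayleigh quotient only sees the remainder; hence
    [lam (D^n) = O(eps^2)], so at most [D^n] eigenvalues exceed [eps / 2].

    Metric entropy is bounded directly rather than through the eigenvalues: on the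
    unit ball of the RKHS the feature coefficients lie in [[-1, 1]], and the part of
    the function outside the first [D^n] features is uniformly [O(eps)].  Rounding
    the coefficients to a grid of mesh about [eps / D^n] gives a net whose
    log-cardinality is [O(D^n L)]. *)
Require Import Defs.
From HB Require Import structures.
From mathcomp Require Import all_boot all_order all_algebra.
From mathcomp Require Import all_classical all_reals all_analysis.
From mathcomp Require Import measurable_realfun ring lra.
Import Order.TTheory GRing.Theory Num.Theory.
Import numFieldNormedType.Exports.
Local Open Scope classical_set_scope.
Local Open Scope ring_scope.

(** * Truncation errors for the exponential series and for products *)

Definition exp_trunc (R : realType) (D : nat) (t : R) : R :=
  \sum_(k < D) t ^+ k / k`!%:R.

Lemma cvg_exp_trunc (R : realType) (t : R) :
  exp_trunc R ^~ t @ \oo --> expR t.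
Proof.
have -> : exp_trunc R ^~ t = series (exp_coeff t).
  by apply: funext => D; rewrite /exp_trunc seriesEord.
exact: is_cvg_series_exp_coeff.
Qed.

Lemma exp_trunc_le_expR (R : realType) (D : nat) (t : R) :
  0 <= t -> exp_trunc R D t <= expR t.
Proof.
move=> t0; have ct := cvg_exp_trunc R t.
rewrite -(cvg_lim _ ct)//.
apply: nondecreasing_cvgn_le; last by apply/cvg_ex; exists (expR t).
apply/nondecreasing_seqP => m; rewrite /exp_trunc big_ord_recr /= lerDl.
by rewrite divr_ge0// exprn_ge0.
Qed.

Lemma ler_norm_exp_term (R : realType) (k : nat) (t B : R) :
  `|t| <= B -> `|t ^+ k / k`!%:R| <= B ^+ k / k`!%:R.
Proof.
move=> tB; rewrite normrM normrX [`|_^-1|]ger0_norm ?invr_ge0//.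
by rewrite ler_wpM2r ?invr_ge0// lerXn2r// nnegrE (le_trans _ tB).
Qed.

Lemma ler_norm_exp_trunc (R : realType) (D : nat) (t B : R) :
  `|t| <= B -> `|exp_trunc R D t| <= expR B.
Proof.
move=> tB; apply: le_trans (ler_norm_sum _ _ _) _.
apply: le_trans (exp_trunc_le_expR R D B (le_trans (normr_ge0 t) tB)).
by apply: ler_sum => i _; exact: ler_norm_exp_term.
Qed.

(* Chernoff's trick: [B^k <= Z^-D (BZ)^k] for [k >= D]. *)
Lemma exp_trunc_tail (R : realType) (D : nat) (t B Z : R) :
  `|t| <= B -> 1 <= Z ->
  `|expR t - exp_trunc R D t| <= expR (B * Z) / Z ^+ D.
Proof.
move=> tB Z1; have B0 : 0 <= B := le_trans (normr_ge0 t) tB.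
have Z0 : 0 < Z by lra.
have ZD0 : 0 < Z ^+ D by rewrite exprn_gt0.
have step m : `|exp_trunc R (D + m) t - exp_trunc R D t| <= expR (B * Z) / Z ^+ D.
  rewrite /exp_trunc big_split_ord /= addrAC subrr add0r.
  apply: le_trans (ler_norm_sum _ _ _) _.
  rewrite ler_pdivlMr// mulr_suml.
  apply: le_trans (exp_trunc_le_expR R (D + m) (B * Z) _); last by rewrite mulr_ge0// ltW.
  rewrite /exp_trunc big_split_ord /=.
  apply: ler_wpDl.
    by apply: sumr_ge0 => i _; rewrite divr_ge0// exprn_ge0// mulr_ge0// ltW.
  apply: ler_sum => i _.
  apply: le_trans (_ : B ^+ (D + i) / (D + i)`!%:R * Z ^+ D <= _).
    by rewrite ler_wpM2r ?(ltW ZD0)// ler_norm_exp_term.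
  rewrite mulrAC ler_wpM2r ?invr_ge0// exprMn ler_wpM2l ?exprn_ge0//.
  by rewrite ler_weXn2l// leq_addr.
have cD : (fun m => `|exp_trunc R (m + D) t - exp_trunc R D t|) @ \oo
    --> `|expR t - exp_trunc R D t|.
  apply: cvg_norm; apply: cvgB; last exact: cvg_cst.
  by rewrite (cvg_shiftn D (exp_trunc R ^~ t)); exact: cvg_exp_trunc.
rewrite -(cvg_lim _ cD)//; apply: limr_le; first by apply/cvg_ex; exists `|expR t - exp_trunc R D t|.
by apply: nearW => m; rewrite addnC.
Qed.

(** With [L = ln (1/eps)] and [Z = sqrt L], any [D >= 8 L / ln L] gives
    [Z^D = e^(D ln L / 2) >= e^(4L)], while [A e^(BZ) <= e^(2L)]; the quotient is at most
    [e^(-2L) = eps^2]. Rounding [D] up costs at most [1 <= L / ln L], hence the 9. *)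
Lemma exp_trunc_degree (R : realType) (A B : R) : 0 < A -> 0 < B ->
  exists2 delta : R, 0 < delta & forall eps, 0 < eps < delta ->
  exists D, exists Z : R, [/\ 1 <= Z, (0 < D)%N,
    D%:R <= 9 * (ln eps^-1 / ln (ln eps^-1)) &
    A * (expR (B * Z) / Z ^+ D) <= eps ^+ 2].
Proof.
(* This threshold forces [L > 2 + A + B^2], hence [ln L > 0], [ln A <= L] and [B <= sqrt L]. *)
move=> A0 B0; exists (expR (- (2 + A + B ^+ 2))); first exact: expR_gt0.
move=> eps /andP[e0 ed]; set L := ln eps^-1.
have epsE : eps = expR (- L) by rewrite /L lnV ?posrE// opprK lnK.
have LA : 2 + A + B ^+ 2 < L by move: ed; rewrite {1}epsE ltr_expR; lra.
have B20 : 0 <= B ^+ 2 by exact: sqr_ge0.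
have L0 : 0 < L by lra.
have lnL0 : 0 < ln L by apply: ln_gt0; lra.
have lnLL : ln L < L by exact: ln_sublinear.
have q1 : 1 <= L / ln L by rewrite ler_pdivlMr// mul1r ltW.
set x := 8 * (L / ln L).
have x0 : 0 <= x by rewrite /x; lra.
have /andP[tx1 tx2] := truncn_itv x0.
have Z0 : 0 < Num.sqrt L by rewrite sqrtr_gt0.
have ZZ : Num.sqrt L ^+ 2 = L by rewrite sqr_sqrtr// ltW.
exists (Num.truncn x).+1, (Num.sqrt L); split=> //.
- by rewrite -[1]sqrtr1 ler_sqrt//; lra.
- by rewrite -natr1; move: tx1; rewrite /x; lra.
have lnZ : Num.sqrt L = expR (ln L / 2).
  rewrite -[LHS]lnK ?posrE//; congr expR.
  by rewrite -{2}ZZ lnXn// mulr2n; lra.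
have {1}-> : A = expR (ln A) by rewrite lnK.
rewrite {2}lnZ -expRM_natl -expRB -expRD epsE -expRM_natl ler_expR.
have lnA : ln A < A by exact: ln_sublinear.
have BZ : B * Num.sqrt L <= L.
  rewrite -{2}ZZ expr2 ler_wpM2r ?(ltW Z0)//.
  rewrite -[B]ger0_norm ?(ltW B0)// -sqrtr_sqr ler_sqrt//; lra.
have : x * ln L <= (Num.truncn x).+1%:R * ln L.
  by rewrite ler_wpM2r ?ltW.
rewrite /x mulrA -mulrA mulrAC -mulrA mulVf ?gt_eqF//.
lra.
Qed.

(** The factors are exchanged one at a time; [1 <= M] allows the exponent [n] although only [n - 1]
    other factors remain. *)
Lemma ler_norm_prodB (R : realFieldType) (n : nat) (a b : 'I_n -> R) (M d : R) :
  1 <= M -> (forall i, `|a i| <= M) -> (forall i, `|b i| <= M) ->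
  (forall i, `|a i - b i| <= d) ->
  `|\prod_i a i - \prod_i b i| <= n%:R * M ^+ n * d.
Proof.
move=> M1; have M0 : 0 <= M by lra.
elim: n a b => [|n IH] a b aM bM abd.
  by rewrite !big_ord0 subrr normr0 !mul0r.
have d0 : 0 <= d := le_trans (normr_ge0 _) (abd ord0).
rewrite !big_ord_recl; set A := \prod_i a _; set B := \prod_i b _.
have AM : `|A| <= M ^+ n.+1.
  rewrite normr_prod; apply: (@le_trans _ _ (\prod_(i < n) M)).
    by apply: ler_prod => i _; rewrite normr_ge0 aM.
  by rewrite prodr_const card_ord ler_weXn2l.
have AB : `|A - B| <= n%:R * M ^+ n * d by apply: IH.
rewrite (_ : _ - _ = (a ord0 - b ord0) * A + b ord0 * (A - B)); last by ring.
apply: le_trans (ler_normD _ _) _; rewrite !normrM.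
apply: (@le_trans _ _ (d * M ^+ n.+1 + M * (n%:R * M ^+ n * d))).
  by rewrite lerD// ler_pM.
by rewrite exprS -natr1 le_eqVlt; apply/orP; left; apply/eqP; ring.
Qed.

(** * Feature expansion of the Gaussian kernel and of its RKHS norm *)

Section Features.
Context {R : realType} {n : nat}.
Local Notation pt := (n.-tuple R).
Implicit Types (x y : pt) (s : seq (R * pt)).

(** Gaussian-weighted monomials with multi-index [a]. The square roots split each Taylor coefficient
    [(2 sigma^2)^k / k!] evenly between the two arguments of the kernel. *)
Definition feature (sigma : R) (a : 'I_n -> nat) x : R :=
  expR (- (sigma ^+ 2 * \sum_i tnth x i ^+ 2)) *
  \prod_i ((Num.sqrt 2 * sigma * tnth x i) ^+ a i / Num.sqrt (a i)`!%:R).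

Definition trunc_gaussK (sigma : R) (D : nat) x y : R :=
  expR (- (sigma ^+ 2 * \sum_i tnth x i ^+ 2)) *
  expR (- (sigma ^+ 2 * \sum_i tnth y i ^+ 2)) *
  \prod_i exp_trunc R D (2 * sigma ^+ 2 * (tnth x i * tnth y i)).

(** Distributing the product of sums gives one term per multi-index with entries below [D]. These
    are placed in the larger box of side [D'], so that truncations of different degrees are subsums
    over one index type. *)
Lemma trunc_gaussK_sub (sigma : R) (D D' : nat) x y : (D <= D')%N ->
  trunc_gaussK sigma D x y =
  \sum_(a : {ffun 'I_n -> 'I_D'} | a \in ffun_on [pred j : 'I_D' | (j < D)%N])
     feature sigma (fun i => a i) x * feature sigma (fun i => a i) y.
Proof.
move=> DD'; rewrite /trunc_gaussK.
under eq_bigr => i _.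
  rewrite /exp_trunc (big_ord_widen _ (fun k => (2 * sigma ^+ 2 * (tnth x i * tnth y i)) ^+ k / k`!%:R) DD').
  over.
rewrite bigA_distr_big /= mulr_sumr.
apply: eq_bigr => a _; rewrite /feature mulrACA; congr (_ * _).
rewrite -big_split /=; apply: eq_bigr => i _.
rewrite [RHS]mulrACA -exprMn -invfM -expr2 sqr_sqrtr ?ler0n//; congr (_ ^+ _ / _).
rewrite [RHS]mulrACA; congr (_ * _).
by rewrite mulrACA -!expr2 sqr_sqrtr// ler0n.
Qed.

Lemma trunc_gaussKE (sigma : R) (D : nat) x y :
  trunc_gaussK sigma D x y =
  \sum_(a : {ffun 'I_n -> 'I_D})
     feature sigma (fun i => a i) x * feature sigma (fun i => a i) y.
Proof.
rewrite (trunc_gaussK_sub sigma D D)//; apply: eq_bigl => a.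
by apply/ffun_onP => i; rewrite inE.
Qed.

Lemma gaussKE (sigma : R) x y :
  gaussK sigma x y =
  expR (- (sigma ^+ 2 * \sum_i tnth x i ^+ 2)) *
  expR (- (sigma ^+ 2 * \sum_i tnth y i ^+ 2)) *
  \prod_i expR (2 * sigma ^+ 2 * (tnth x i * tnth y i)).
Proof.
rewrite -expR_sum -!expRD; congr expR; rewrite -mulr_sumr /sqdist.
under eq_bigr do rewrite sqrrB.
rewrite big_split /= sumrB.
under [X in _ - X + _]eq_bigr do rewrite -mulr_natl.
by rewrite -mulr_sumr; ring.
Qed.

Lemma gaussK_diag (sigma : R) x : gaussK sigma x x = 1.
Proof.
by rewrite /gaussK /sqdist big1 ?mulr0 ?oppr0 ?expR0// => i _; rewrite subrr expr0n.
Qed.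

Lemma trunc_gaussK_err (sigma : R) (D : nat) (Z : R) x y : 1 <= Z ->
  cube x -> cube y ->
  `|gaussK sigma x y - trunc_gaussK sigma D x y| <=
    n%:R * expR (2 * sigma ^+ 2) ^+ n * (expR (2 * sigma ^+ 2 * Z) / Z ^+ D).
Proof.
move=> Z1 cx cy; rewrite gaussKE -mulrBr normrM.
have s0 := sqr_ge0 sigma.
have tB i : `|2 * sigma ^+ 2 * (tnth x i * tnth y i)| <= 2 * sigma ^+ 2.
  rewrite normrM ger0_norm; last by lra.
  rewrite ler_piMr//; first by lra.
  by rewrite normrM mulr_ile1// ler_norml ?cx ?cy.
have gle z : expR (- (sigma ^+ 2 * \sum_i tnth z i ^+ 2)) <= 1 :> R.
  rewrite -expR0 ler_expR oppr_le0 mulr_ge0//.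
  by apply: sumr_ge0 => i _; exact: sqr_ge0.
apply: (@le_trans _ _ (`|\prod_(i < n) expR (2 * sigma ^+ 2 * (tnth x i * tnth y i)) -
   \prod_(i < n) exp_trunc R D (2 * sigma ^+ 2 * (tnth x i * tnth y i))|)).
  rewrite ler_piMl// ger0_norm ?mulr_ge0 ?expR_ge0//.
  by rewrite mulr_ile1 ?expR_ge0.
apply: ler_norm_prodB => [|i|i|i].
- by rewrite -[leLHS]expR0 ler_expR; lra.
- rewrite ger0_norm ?expR_ge0// ler_expR.
  exact: le_trans (ler_norm _) (tB i).
- exact: ler_norm_exp_trunc.
- exact: exp_trunc_tail.
Qed.

Lemma cvg_trunc_gaussK (sigma : R) x y :
  (fun D => trunc_gaussK sigma D x y) @ \oo --> gaussK sigma x y.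
Proof.
rewrite gaussKE; apply: cvgMr.
apply: cvg_big => [|i _]; last exact: cvg_exp_trunc.
exact: mul_continuous.
Qed.

Lemma cvg_pre_eval (sigma : R) s x :
  (fun D => pre_eval (trunc_gaussK sigma D) s x) @ \oo --> pre_eval (gaussK sigma) s x.
Proof.
apply: cvg_big => [|i _]; first exact: add_continuous.
exact: cvgMr (cvg_trunc_gaussK _ _ _).
Qed.

Lemma cvg_pre_inner (sigma : R) s t :
  (fun D => pre_inner (trunc_gaussK sigma D) s t) @ \oo --> pre_inner (gaussK sigma) s t.
Proof.
apply: cvg_big => [|i _]; first exact: add_continuous.
apply: cvg_big => [|j _]; first exact: add_continuous.
exact: cvgMr (cvg_trunc_gaussK _ _ _).
Qed.

(** The coordinate of the combination [s] along the feature [a]: truncated evaluation is the sum of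
    [feature * coef], and the truncated squared norm is the sum of [coef^2]. *)
Definition coef (sigma : R) s (a : 'I_n -> nat) : R :=
  \sum_(c <- s) c.1 * feature sigma a c.2.

Lemma pre_eval_trunc (sigma : R) (D D' : nat) s x : (D <= D')%N ->
  pre_eval (trunc_gaussK sigma D) s x =
  \sum_(a : {ffun 'I_n -> 'I_D'} | a \in ffun_on [pred j : 'I_D' | (j < D)%N])
     feature sigma (fun i => a i) x * coef sigma s (fun i => a i).
Proof.
move=> DD'; rewrite /pre_eval.
under eq_bigr => c _ do rewrite (trunc_gaussK_sub _ _ _ _ _ DD') mulr_sumr.
rewrite exchange_big; apply: eq_bigr => a _ /=.
by rewrite /coef mulr_sumr; apply: eq_bigr => c _; rewrite mulrCA.
Qed.

Lemma big_ffun_on_ltn (D : nat) (F : {ffun 'I_n -> 'I_D} -> R) :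
  \sum_(a : {ffun 'I_n -> 'I_D} | a \in ffun_on [pred j : 'I_D | (j < D)%N]) F a =
  \sum_a F a.
Proof. by apply: eq_bigl => a; apply/ffun_onP => i; rewrite inE. Qed.

Lemma pre_innerE (K : pt -> pt -> R) s :
  pre_inner K s s = \sum_(c <- s) c.1 * pre_eval K s c.2.
Proof.
apply: eq_bigr => c _; rewrite mulr_sumr; apply: eq_bigr => d _.
by rewrite -mulrA.
Qed.

Lemma pre_inner_trunc (sigma : R) (D D' : nat) s : (D <= D')%N ->
  pre_inner (trunc_gaussK sigma D) s s =
  \sum_(a : {ffun 'I_n -> 'I_D'} | a \in ffun_on [pred j : 'I_D' | (j < D)%N])
     coef sigma s (fun i => a i) ^+ 2.
Proof.
move=> DD'; rewrite pre_innerE.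
under eq_bigr do rewrite (pre_eval_trunc _ _ _ _ _ DD') mulr_sumr.
rewrite exchange_big; apply: eq_bigr => a _ /=.
by rewrite expr2 {2}/coef mulr_suml; apply: eq_bigr => c _; rewrite mulrA.
Qed.

(** Only multi-indices outside the small box survive in the difference. The bound is
    [|u v| <= (t u^2 + v^2 / t) / 2] for each of them, with [u] the feature and [v] the
    coefficient. *)
Lemma pre_eval_trunc_diff (sigma : R) (D D' : nat) s x : (D <= D')%N ->
  forall t, 0 < t ->
  `|pre_eval (trunc_gaussK sigma D') s x - pre_eval (trunc_gaussK sigma D) s x|
   <= (t * (trunc_gaussK sigma D' x x - trunc_gaussK sigma D x x)
       + t^-1 * (pre_inner (trunc_gaussK sigma D') s s)) / 2.
Proof.
move=> DD' t t0.
rewrite (pre_eval_trunc _ _ _ _ _ DD') (pre_eval_trunc _ D' D')// big_ffun_on_ltn.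
rewrite (trunc_gaussK_sub _ _ _ _ _ DD') (trunc_gaussK_sub _ D' D')// big_ffun_on_ltn.
rewrite (pre_inner_trunc _ D' D')// big_ffun_on_ltn.
set p := [pred a : {ffun 'I_n -> 'I_D'} | a \in ffun_on [pred j : 'I_D' | (j < D)%N]].
rewrite (bigID p) /= addrAC subrr add0r.
rewrite [X in t * (X - _)](bigID p) /= addrAC subrr add0r.
rewrite [X in t^-1 * X](bigID p) /=.
apply: le_trans (ler_norm_sum _ _ _) _.
(* The squared coefficients inside the small box only enlarge the right-hand side. *)
rewrite mulrDr addrCA mulrDl; apply: ler_wpDl.
  by rewrite divr_ge0// mulr_ge0 ?invr_ge0 ?(ltW t0)//; apply: sumr_ge0 => a _; exact: sqr_ge0.
rewrite !mulr_sumr -big_split /= mulr_suml; apply: ler_sum => a _.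
move: (feature _ _ _) (coef _ _ _) => u v.
rewrite ler_pdivlMr//.
have sqE : t^-1 * (t * `|u| - `|v|) ^+ 2 =
    t * `|u| ^+ 2 - `|u| * `|v| * 2 + t^-1 * `|v| ^+ 2.
  by field; rewrite gt_eqF.
have : 0 <= t^-1 * (t * `|u| - `|v|) ^+ 2.
  by rewrite mulr_ge0 ?invr_ge0 ?(ltW t0)// sqr_ge0.
rewrite sqE.
by rewrite normrM !real_normK ?num_real// -expr2; lra.
Qed.

(** The truncated squared norms are growing sums of squares, and their limit is the full squared
    norm. *)
Lemma pre_inner_trunc_le (sigma : R) (D : nat) s :
  pre_inner (trunc_gaussK sigma D) s s <= pre_inner (gaussK sigma) s s.
Proof.
rewrite -(cvg_lim _ (cvg_pre_inner sigma s s))//.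
apply: limr_ge; first by apply/cvg_ex; eexists; exact: cvg_pre_inner.
near=> D'; have DD' : (D <= D')%N by near: D'; exact: nbhs_infty_ge.
rewrite (pre_inner_trunc _ _ _ _ DD') (pre_inner_trunc _ D' D')// big_ffun_on_ltn.
rewrite [leRHS](bigID [pred a : {ffun 'I_n -> 'I_D'} | a \in ffun_on [pred j : 'I_D' | (j < D)%N]]) /=.
by rewrite lerDl; apply: sumr_ge0 => a _; exact: sqr_ge0.
Unshelve. all: by end_near.
Qed.

(** A Bessel inequality: [coef^2] is one term of the truncated squared norm. *)
Lemma coef_le (sigma : R) (D : nat) s (a : {ffun 'I_n -> 'I_D}) :
  coef sigma s (fun i => a i) ^+ 2 <= pre_inner (gaussK sigma) s s.
Proof.
apply: le_trans (pre_inner_trunc_le sigma D s).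
rewrite (pre_inner_trunc _ D D)// big_ffun_on_ltn (bigD1 a)//= lerDl.
by apply: sumr_ge0 => b _; exact: sqr_ge0.
Qed.

(** The feature value at [x] is the coefficient of the kernel section at [x], whose squared norm is
    [K x x = 1]. *)
Lemma feature_le1 (sigma : R) (D : nat) (a : {ffun 'I_n -> 'I_D}) x :
  `|feature sigma (fun i => a i) x| <= 1.
Proof.
have := coef_le sigma D [:: (1, x)] a.
rewrite /coef /pre_inner !big_seq1 /= !mul1r gaussK_diag.
by rewrite -real_normK ?num_real// expr_le1.
Qed.

(* The truncation error at [x] is at most [sqrt (E x x) * |s|], where [E] is the
   remainder kernel; the free parameter [t] replaces the square root. *)
Lemma pre_eval_trunc_err (sigma : R) (D : nat) s x (t : R) : 0 < t ->
  `|pre_eval (gaussK sigma) s x - pre_eval (trunc_gaussK sigma D) s x|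
   <= (t * (gaussK sigma x x - trunc_gaussK sigma D x x)
       + t^-1 * (pre_inner (gaussK sigma) s s)) / 2.
Proof.
move=> t0.
have cl : (fun D' => `|pre_eval (trunc_gaussK sigma D') s x
    - pre_eval (trunc_gaussK sigma D) s x|) @ \oo -->
    `|pre_eval (gaussK sigma) s x - pre_eval (trunc_gaussK sigma D) s x|.
  apply: cvg_norm; apply: cvgB; [exact: cvg_pre_eval|exact: cvg_cst].
have cr : (fun D' => (t * (trunc_gaussK sigma D' x x - trunc_gaussK sigma D x x)
    + t^-1 * pre_inner (trunc_gaussK sigma D') s s) / 2) @ \oo -->
    (t * (gaussK sigma x x - trunc_gaussK sigma D x x)
      + t^-1 * pre_inner (gaussK sigma) s s) / 2.
  apply: cvgMl; apply: cvgD; apply: cvgMr; last exact: cvg_pre_inner.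
  apply: cvgB; [exact: cvg_trunc_gaussK|exact: cvg_cst].
apply: ler_cvg_to cl cr _.
near=> D'; apply: pre_eval_trunc_diff => //.
by near: D'; exact: nbhs_infty_ge.
Unshelve. all: by end_near.
Qed.

End Features.

(** * Continuity of finite combinations of features *)

Section Continuity.
Context {R : realType} {n : nat}.
Local Notation pt := (n.-tuple R).

(** Convergence along this filter is exactly the epsilon-delta condition of [cont_on_cube], so the
    general limit rules apply to it. *)
Definition cube_nbhs (x : pt) : set_system pt :=
  filter_from [set d : R | 0 < d] (fun d => [set y | cube y /\ sqdist x y < d ^+ 2]).

#[local] Instance cube_nbhs_filter (x : pt) : Filter (cube_nbhs x).
Proof.
apply: filter_from_filter; first by exists 1; exact: ltr01.
move=> d e /= d0 e0; exists (Num.min d e); first by rewrite /= lt_min d0.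
have m0 : 0 <= Num.min d e by rewrite le_min !ltW.
move=> y [cy yde]; split; (split; [exact: cy|apply: (lt_le_trans yde)]).
- by rewrite lerXn2r ?nnegrE ?(ltW d0)// ge_min lexx.
- by rewrite lerXn2r ?nnegrE ?(ltW e0)// ge_min lexx orbT.
Qed.

Lemma cont_on_cubeP (c : pt -> R) :
  (forall x, cube x -> c @ cube_nbhs x --> c x) -> cont_on_cube c.
Proof.
move=> cc x cx e e0.
have /cvgrPdist_lt/(_ e e0)[d d0 dP] := cc x cx.
by exists d => // y cy xy; apply: dP.
Qed.

Lemma cvg_tnth (x : pt) (i : 'I_n) : (fun y : pt => tnth y i) @ cube_nbhs x --> tnth x i.
Proof.
apply/cvgrPdist_lt => e e0; exists e => // y [_ xy] /=.
rewrite -(ltr_pXn2r (n := 2))// ?nnegrE ?(ltW e0)// real_normK ?num_real//.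
apply: le_lt_trans xy; rewrite /sqdist (bigD1 i)//= lerDl.
by apply: sumr_ge0 => j _; exact: sqr_ge0.
Qed.

Lemma cvg_feature (sigma : R) (a : 'I_n -> nat) (x : pt) :
  feature sigma a @ cube_nbhs x --> feature sigma a x.
Proof.
apply: cvgM.
  apply: (continuous_cvg _ (h := expR)); first exact: continuous_expR.
  apply: cvgN; apply: cvgMr; apply: cvg_big => [|i _]; first exact: add_continuous.
  apply: (continuous_cvg _ (h := fun u : R => u ^+ 2)).
    exact: exprn_continuous.
  exact: cvg_tnth.
apply: cvg_big => [|i _]; first exact: mul_continuous.
apply: cvgMl.
apply: (continuous_cvg _ (h := fun u : R => u ^+ a i)); first exact: exprn_continuous.
by apply: cvgMr; exact: cvg_tnth.
Qed.

Lemma cont_feature_sum (sigma : R) (I : finType) (a : I -> 'I_n -> nat) (b : I -> R) :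
  cont_on_cube (fun x => \sum_(j : I) feature sigma (a j) x * b j).
Proof.
apply: cont_on_cubeP => x _.
apply: cvg_big => [|j _]; first exact: add_continuous.
by apply: cvgMl; exact: cvg_feature.
Qed.

End Continuity.

(** * Rounding coefficients, and the net for the unit ball *)

Definition grid (R : realType) (M : nat) (j : 'I_M.+1) : R := 2 * (j%:R / M%:R) - 1.

Lemma grid_round (R : realType) (M : nat) (a : R) : (0 < M)%N -> `|a| <= 1 ->
  exists j : 'I_M.+1, `|a - grid R M j| <= 2 / M%:R.
Proof.
move=> M0 a1; have M0R : 0 < M%:R :> R by rewrite ltr0n.
have /andP[la ua] : -1 <= a <= 1 by rewrite -ler_norml.
set x := (a + 1) / 2 * M%:R.
have x0 : 0 <= x by rewrite /x mulr_ge0 ?ler0n//; lra.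
have /andP[t1 t2] := truncn_itv x0.
(* The endpoint [a = 1] is sent to the index [M] itself, hence [M.+1] grid points. *)
have tM : (Num.truncn x < M.+1)%N.
  rewrite -(ltr_nat R) (le_lt_trans t1)// -natr1 ltr_pwDr// /x ler_piMl//; lra.
exists (Ordinal tM); rewrite /grid /=.
have -> : a - (2 * ((Num.truncn x)%:R / M%:R) - 1) = (x - (Num.truncn x)%:R) * (2 / M%:R).
  by rewrite /x; field; rewrite gt_eqF.
rewrite normrM [`|2 / _|]ger0_norm ?divr_ge0// ler_piMl ?divr_ge0//.
rewrite ger0_norm ?subr_ge0//; move: t2; rewrite -natr1; lra.
Qed.

(** The centres are the feature sums with grid coefficients. Passing from [f] to an approximant,
    truncating it and rounding its coefficients cost [eps / 4] each; the total [3 eps / 4] keeps the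
    inequality strict after taking the supremum. *)
Lemma rkhs_ball_covered (R : realType) (n : nat) (sigma : R) (D M : nat) (eps : R) :
  (0 < M)%N -> 0 < eps ->
  (forall x : n.-tuple R, cube x ->
     gaussK sigma x x - trunc_gaussK sigma D x x <= eps ^+ 2 / 16) ->
  8 * (D ^ n)%:R <= M%:R * eps ->
  Defs.covered_by (rkhs_open_ball (@gaussK R n sigma)) eps (M.+1 ^ (D ^ n)).
Proof.
move=> M0 e0 tail MD; have M0R : 0 < M%:R :> R by rewrite ltr0n.
pose I := {ffun 'I_n -> 'I_D}; pose J := {ffun I -> 'I_M.+1}.
have cI : #|I| = (D ^ n)%N by rewrite card_ffun !card_ord.
have cJ : #|J| = (M.+1 ^ (D ^ n))%N by rewrite card_ffun card_ord cI.
pose g (j : J) (x : n.-tuple R) : R :=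
  \sum_(a : I) feature sigma (fun i => a i) x * grid R M (j a).
exists (fun j => g (enum_val (cast_ord (esym cJ) j))).
split=> [j|f [s [_ _ sf [r r1 [N sN]]]]].
  exact: cont_feature_sum.
suff [j fj] : exists j : J, forall x, cube x -> `|f x - g j x| <= 3 / 4 * eps.
  exists (cast_ord cJ (enum_rank j)); rewrite cast_ordK enum_rankK.
  apply: (@le_lt_trans _ _ (3 / 4 * eps)%:E); last by rewrite lte_fin; lra.
  by apply: ge_ereal_sup => _ [x cx <-]; rewrite lee_fin fj.
(* The approximants are only known to converge pointwise. If every centre [j] failed, at a point
   [x j] say, then one index [k0] would serve these finitely many points, and rounding the
   coefficients of [s k0] would give a centre that succeeds at its own bad point. *)
apply: contrapT => /forallNP nfj.
have /choice[x xP] : forall j : J, exists x, cube x /\ 3 / 4 * eps < `|f x - g j x|.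
  move=> j; apply: contrapT => /forallNP nx; apply: (nfj j) => x cx.
  by rewrite leNgt; apply/negP => xj; apply: (nx x).
have : \forall k \near \oo, (N <= k)%N /\
    forall j, `|f (x j) - pre_eval (gaussK sigma) (s k) (x j)| < eps / 4.
  near=> k; split; first by near: k; exact: nbhs_infty_ge.
  near: k; apply: filter_forall => j.
  have := sf (x j) (xP j).1 => /cvgrPdist_lt; apply.
  by rewrite divr_gt0.
case=> k0 _ /(_ k0 (leqnn k0))[Nk0 fk0].
have pk : pre_inner (gaussK sigma) (s k0) (s k0) <= 1 := le_trans (sN _ Nk0) (ltW r1).
have /choice[j jP] : forall a : I, exists j : 'I_M.+1,
    `|coef sigma (s k0) (fun i => a i) - grid R M j| <= 2 / M%:R.
  move=> a; apply: grid_round => //.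
  have := le_trans (coef_le sigma D (s k0) a) pk.
  by rewrite -real_normK ?num_real// expr_le1.
pose j' : J := [ffun a => j a].
have [cx] := xP j'; rewrite ltNge => /negP; apply.
have h1 := ltW (fk0 j'); set y := x j' in cx h1 *.
(* The value [t = 4 / eps] balances the two terms: [t * eps^2 / 16 = t^-1 = eps / 4]. *)
have t0 : 0 < 4 / eps by rewrite divr_gt0.
have h2 : `|pre_eval (gaussK sigma) (s k0) y - pre_eval (trunc_gaussK sigma D) (s k0) y| <= eps / 4.
  apply: le_trans (pre_eval_trunc_err sigma D (s k0) y _ t0) _.
  have -> : eps / 4 = (4 / eps * (eps ^+ 2 / 16) + (4 / eps)^-1 * 1) / 2.
    by field; rewrite gt_eqF.
  rewrite ler_pM2r ?invr_gt0// lerD// ler_wpM2l ?invr_ge0 ?(ltW t0)//.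
  exact: tail.
(* There are [D^n] coefficients, each off by at most [2 / M], against features bounded by 1. *)
have h3 : `|pre_eval (trunc_gaussK sigma D) (s k0) y - g j' y| <= eps / 4.
  rewrite (pre_eval_trunc sigma D D)// big_ffun_on_ltn /g -sumrB.
  apply: le_trans (ler_norm_sum _ _ _) _.
  apply: (@le_trans _ _ (\sum_(a : I) 2 / M%:R)).
    apply: ler_sum => a _; rewrite -mulrBr normrM ffunE.
    rewrite -[leRHS]mul1r ler_pM//; exact: feature_le1.
  rewrite sumr_const cI -[leLHS]mulr_natr mulrAC ler_pdivrMr//; lra.
rewrite (_ : f y - g j' y = (f y - pre_eval (gaussK sigma) (s k0) y)
  + ((pre_eval (gaussK sigma) (s k0) y - pre_eval (trunc_gaussK sigma D) (s k0) y)
  + (pre_eval (trunc_gaussK sigma D) (s k0) y - g j' y))); last by ring.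
apply: le_trans (ler_normD _ _) _.
have := ler_normD (pre_eval (gaussK sigma) (s k0) y - pre_eval (trunc_gaussK sigma D) (s k0) y)
  (pre_eval (trunc_gaussK sigma D) (s k0) y - g j' y).
lra.
Unshelve. all: by end_near.
Qed.

(** * Eigenvalues of a kernel uniformly close to finite rank *)

Section Rintegral_finite_sums.
Context d (T : measurableType d) (R : realType) (mu : {measure set T -> \bar R}).
Context (A : set T).
Hypothesis mA : measurable A.
Implicit Types f g : T -> R.

Lemma dominated_integrable f g : measurable_fun A f ->
  (forall x, A x -> `|f x| <= g x) ->
  mu.-integrable A (EFin \o g) -> mu.-integrable A (EFin \o f).
Proof.
move=> mf fg; apply: le_integrable => //; first exact/measurable_EFinP.
by move=> x Ax /=; rewrite lee_fin (le_trans (fg x Ax))// ler_norm.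
Qed.

Lemma integrable_sumr (I : Type) (s : seq I) (f : I -> T -> R) :
  (forall i, mu.-integrable A (EFin \o f i)) ->
  mu.-integrable A (EFin \o (fun x => \sum_(i <- s) f i x)).
Proof.
move=> fi; have := @integrable_sum _ _ _ mu A mA _ s xpredT (fun i => EFin \o f i).
move=> /(_ (fun i _ => fi i)); apply: eq_integrable => // x _ /=.
by rewrite sumEFin.
Qed.

Lemma integrable_scale (c : R) f :
  mu.-integrable A (EFin \o f) -> mu.-integrable A (EFin \o (fun x => c * f x)).
Proof.
by move=> /(integrableZl mA c); apply: eq_integrable => // x _ /=; rewrite EFinM.
Qed.

Lemma Rintegral_sum (I : Type) (s : seq I) (c : I -> R) (f : I -> T -> R) :
  (forall i, mu.-integrable A (EFin \o f i)) ->
  \int[mu]_(x in A) (\sum_(i <- s) c i * f i x) =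
  \sum_(i <- s) c i * \int[mu]_(x in A) f i x.
Proof.
move=> fi; elim: s => [|i s IH].
  under eq_Rintegral do rewrite big_nil.
  by rewrite big_nil Rintegral_cst// mul0r.
under eq_Rintegral do rewrite big_cons.
rewrite RintegralD//; first by rewrite RintegralZl// IH big_cons.
  exact: integrable_scale.
by apply: (integrable_sumr _ s (fun i x => c i * f i x)) => j; exact: integrable_scale.
Qed.

End Rintegral_finite_sums.

(** [N + 1] vectors in dimension [N] are linearly dependent; the relation is then normalised. *)
Lemma exists_unit_kernel (R : rcfType) (N : nat) (G : 'I_N.+1 -> 'I_N -> R) :
  exists2 a : 'I_N.+1 -> R, \sum_k a k ^+ 2 = 1 &
    forall l, \sum_k a k * G k l = 0.
Proof.
pose M : 'M[R]_(N.+1, N) := \matrix_(k, l) G k l.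
have kM0 : kermx M != 0.
  rewrite kermx_eq0 /row_free neq_ltn; apply/orP; left.
  by rewrite ltnS rank_leq_col.
have /rowV0Pn[v /sub_kermxP vM v0] := kM0.
pose S := \sum_k v ord0 k ^+ 2.
have S0 : 0 < S.
  rewrite lt_neqAle sumr_ge0 ?andbT; last by move=> k _; exact: sqr_ge0.
  apply: contra v0; rewrite eq_sym => /eqP S0; apply/eqP/rowP => k; rewrite mxE.
  apply/eqP; rewrite -sqrf_eq0.
  move/eqP: S0; rewrite psumr_eq0; last by move=> j _; exact: sqr_ge0.
  by move/allP => /(_ k (mem_index_enum k)).
exists (fun k => v ord0 k / Num.sqrt S) => [|l].
  under eq_bigr do rewrite exprMn exprVn sqr_sqrtr ?(ltW S0)//.
  by rewrite -mulr_suml divff ?gt_eqF.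
under eq_bigr do rewrite mulrAC.
rewrite -mulr_suml; apply/eqP; rewrite mulf_eq0; apply/orP; left; apply/eqP.
have /rowP/(_ l) := vM; rewrite !mxE => vMl.
by rewrite -[RHS]vMl; apply: eq_bigr => k _; rewrite mxE.
Qed.

(** A min-max argument: some unit combination [psi] of the first [N + 1] eigenfunctions is
    orthogonal to all [v l]. Its Rayleigh quotient is at least [lam N], and it is at most [delta]
    times the squared L1 norm of [psi], since only the remainder of the kernel acts on [psi]. *)
Lemma eigenvalue_finite_rank d (T : measurableType d) (R : realType)
    (mu : {measure set T -> \bar R}) (A : set T) (m delta : R)
    (K : T -> T -> R) (N : nat) (u v : 'I_N -> T -> R)
    (lam : nat -> R) (phi : nat -> T -> R) :
  measurable A -> mu A = m%:E -> 0 <= delta ->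
  {homo lam : i j / (i <= j)%N >-> j <= i} ->
  (forall i, measurable_fun A (phi i)) ->
  (forall i j, (\int[mu]_(x in A) (phi i x * phi j x)%:E = (if i == j then 1 else 0)%:E)%E) ->
  (forall i, {ae mu, forall x, A x ->
     (\int[mu]_(y in A) (K x y * phi i y)%:E = (lam i * phi i x)%:E)%E}) ->
  (forall x, A x -> measurable_fun A (K x)) ->
  (forall l, measurable_fun A (v l)) ->
  (forall l x, A x -> `|v l x| <= 1) ->
  (forall x y, A x -> A y -> `|K x y - \sum_l u l x * v l y| <= delta) ->
  lam N <= delta * ((1 + m) / 2) ^+ 2.
Proof.
move=> mA muA delta0 lamd mphi ortho eig mK mv v1 Kuv.
have muAoo : (mu A < +oo)%E by rewrite muA ltry.
have m0 : 0 <= m by rewrite -lee_fin -muA.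
have icst c : mu.-integrable A (EFin \o (fun=> c : R)).
  apply: measurable_bounded_integrable => //.
  by exists `|c|; split; [exact: num_real|move=> z cz y _ /=; exact: ltW].
have iphi2 i : mu.-integrable A (EFin \o (fun x => phi i x * phi i x)).
  apply/integrableP; split; first by apply/measurable_EFinP; exact: measurable_funM.
  under eq_integral => x _ do rewrite /= ger0_norm -?expr2 ?sqr_ge0// expr2.
  by rewrite ortho eqxx ltry.
have iphi i : mu.-integrable A (EFin \o phi i).
  apply: (dominated_integrable _ _ _ _ _ mA _ (fun x => 1 + phi i x * phi i x)) => //.
    move=> x _; have := sqr_ge0 (`|phi i x| - 1).
    have : phi i x * phi i x = `|phi i x| ^+ 2 by rewrite real_normK ?num_real.
    by rewrite sqrrB1 mulr2n; have := normr_ge0 (phi i x); have := sqr_ge0 (phi i x); rewrite expr2; lra.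
  have := integrableD mA (icst 1) (iphi2 i).
  by apply: eq_integrable => // x _ /=.
have iphiM i j : mu.-integrable A (EFin \o (fun x => phi i x * phi j x)).
  apply: (dominated_integrable _ _ _ _ _ mA _ (fun x => phi i x * phi i x + phi j x * phi j x)) => //.
  - exact: measurable_funM.
  - move=> x _; rewrite normrM.
    have := sqr_ge0 (`|phi i x| - `|phi j x|); rewrite sqrrB !real_normK ?num_real// !expr2.
    by have := normr_ge0 (phi i x); have := normr_ge0 (phi j x); nra.
  - have := integrableD mA (iphi2 i) (iphi2 j).
    by apply: eq_integrable => // x _ /=.
have ibdd (h : T -> R) (c : R) i : measurable_fun A h -> (forall x, A x -> `|h x| <= c) ->
    mu.-integrable A (EFin \o (fun x => h x * phi i x)).
  move=> mh hc.
  apply: (dominated_integrable _ _ _ _ _ mA _ (fun x => c * `|phi i x|)) => //.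
  - exact: measurable_funM.
  - by move=> x Ax; rewrite normrM ler_wpM2r// hc.
  - apply: integrable_scale => //; have := integrable_norm (iphi i).
    by apply: eq_integrable.
have [a a1 a0] := exists_unit_kernel R N
  (fun k l => \int[mu]_(y in A) (v l y * phi k y)).
(* [F] is almost everywhere the image of [psi] under the integral operator. *)
pose psi x := \sum_(k < N.+1) a k * phi k x.
pose F x := \sum_(k < N.+1) (a k * lam k) * phi k x.
have lin (g : nat -> T -> R) (b : 'I_N.+1 -> R) :
    (forall k, mu.-integrable A (EFin \o g k)) ->
    mu.-integrable A (EFin \o (fun x => \sum_(k < N.+1) b k * g k x)).
  move=> ig; apply: (integrable_sumr _ _ _ _ _ mA _ _ (fun (k : 'I_N.+1) x => b k * g k x)) => k.
  exact: integrable_scale.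
have ipsi : mu.-integrable A (EFin \o psi) by exact: lin.
have mpsi : measurable_fun A psi by apply/measurable_EFinP; have /integrableP[] := ipsi.
have iF : mu.-integrable A (EFin \o F) by exact: (lin _ (fun k => a k * lam k)).
have mF : measurable_fun A F by apply/measurable_EFinP; have /integrableP[] := iF.
have mulpsi (h : T -> R) x : h x * psi x = \sum_(k < N.+1) a k * (h x * phi k x).
  by rewrite /psi mulr_sumr; apply: eq_bigr => k _; rewrite mulrCA.
have iphipsi k : mu.-integrable A (EFin \o (fun x => phi k x * psi x)).
  under eq_fun do rewrite mulpsi.
  by apply: (lin (fun l x => phi k x * phi l x)).
have Jphipsi (k : 'I_N.+1) : \int[mu]_(x in A) (phi k x * psi x) = a k.
  under eq_Rintegral do rewrite mulpsi.
  rewrite (Rintegral_sum _ _ _ _ _ mA _ _ a (fun l x => phi k x * phi l x))//.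
  rewrite (bigD1 k)//= [X in X + _](_ : _ = a k); last by rewrite /Rintegral ortho eqxx mulr1.
  rewrite big1 ?addr0// => l lk.
  by rewrite /Rintegral ortho (_ : _ == _ = false) ?mulr0// eq_sym; exact: negbTE.
have bilE (b : 'I_N.+1 -> R) x :
    (\sum_(k < N.+1) b k * phi k x) * psi x = \sum_(k < N.+1) b k * (phi k x * psi x).
  by rewrite mulr_suml; apply: eq_bigr => k _; rewrite mulrA.
have ibil (b : 'I_N.+1 -> R) :
    mu.-integrable A (EFin \o (fun x => (\sum_(k < N.+1) b k * phi k x) * psi x)).
  under eq_fun do rewrite bilE.
  by apply: (lin (fun k x => phi k x * psi x)).
have Jbil (b : 'I_N.+1 -> R) :
    \int[mu]_(x in A) ((\sum_(k < N.+1) b k * phi k x) * psi x) = \sum_k b k * a k.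
  under eq_Rintegral do rewrite bilE.
  rewrite (Rintegral_sum _ _ _ _ _ mA _ _ b (fun k x => phi k x * psi x))//.
  by apply: eq_bigr => k _; rewrite Jphipsi.
have inpsi : mu.-integrable A (EFin \o (fun x => `|psi x|)).
  exact: integrable_norm ipsi.
(* This bounds the L1 norm of [psi], by [2 |psi| <= 1 + psi^2] and the unit L2 norm. *)
pose c := (1 + m) / 2.
have c0 : 0 <= c by rewrite /c; lra.
have Jpsi : \int[mu]_(x in A) `|psi x| <= c.
  have i1 : mu.-integrable A (EFin \o (fun x => 1 + psi x * psi x)).
    have := integrableD mA (icst 1) (ibil a).
    by apply: eq_integrable => // x _ /=.
  apply: (@le_trans _ _ (\int[mu]_(x in A) (2^-1 * (1 + psi x * psi x)))).
    apply: le_Rintegral => //; first exact: integrable_scale.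
    move=> x _; rewrite -expr2 -[psi x ^+ 2]real_normK ?num_real//.
    by have := sqr_ge0 (`|psi x| - 1); rewrite sqrrB1 mulr2n; lra.
  rewrite RintegralZl// RintegralD//; last exact: ibil.
  rewrite Jbil Rintegral_cst// muA.
  under eq_bigr do rewrite -expr2.
  by rewrite a1 /c /=; lra.
have Fx x : A x -> (forall k : 'I_N.+1, (\int[mu]_(y in A) (K x y * phi k y)%:E =
    (lam k * phi k x)%:E)%E) -> `|F x| <= delta * c.
  move=> Ax eigx.
  pose E y := K x y - \sum_l u l x * v l y.
  have mP : measurable_fun A (fun y => \sum_l u l x * v l y).
    by apply: measurable_sum => l; apply: measurable_funM.
  have mE : measurable_fun A E by apply: measurable_funB => //; exact: mK.
  have Ed y : A y -> `|E y| <= delta by move=> Ay; exact: Kuv.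
  have iE k : mu.-integrable A (EFin \o (fun y => E y * phi k y)) by exact: ibdd Ed.
  have iv l k : mu.-integrable A (EFin \o (fun y => v l y * phi k y)).
    by apply: ibdd => //; exact: v1.
  have JK k : \int[mu]_(y in A) (K x y * phi k y) = \int[mu]_(y in A) (E y * phi k y)
      + \sum_l u l x * \int[mu]_(y in A) (v l y * phi k y).
    rewrite -(Rintegral_sum _ _ _ _ _ mA _ _ _ (fun l y => v l y * phi k y))//.
    rewrite -RintegralD//; last first.
      apply: (integrable_sumr _ _ _ _ _ mA _ _ (fun l y => u l x * (v l y * phi k y))) => l.
      exact: integrable_scale.
    apply: eq_Rintegral => y _; rewrite /E mulrBl mulr_suml.
    by under [X in _ - X + _]eq_bigr do rewrite -mulrA; rewrite subrK.
  have uv0 : \sum_(k < N.+1) a k *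
      (\sum_l u l x * \int[mu]_(y in A) (v l y * phi k y)) = 0.
    under eq_bigr do rewrite mulr_sumr.
    rewrite exchange_big big1// => l _.
    under eq_bigr do rewrite mulrCA.
    by rewrite -mulr_sumr a0 mulr0.
  (* The finite-rank part of the kernel integrates to 0 against [psi]. *)
  have FE : F x = \int[mu]_(y in A) (E y * psi y).
    under eq_Rintegral do rewrite mulpsi.
    rewrite (Rintegral_sum _ _ _ _ _ mA _ _ a (fun k y => E y * phi k y))//.
    rewrite /F -[RHS]addr0 -[X in _ = _ + X]uv0 -big_split; apply: eq_bigr => k _ /=.
    by rewrite -mulrDr -JK /Rintegral eigx mulrA.
  rewrite FE.
  have iEpsi : mu.-integrable A (EFin \o (fun y => E y * psi y)).
    under eq_fun do rewrite mulpsi.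
    by apply: (lin (fun k y => E y * phi k y)).
  apply: le_trans (le_normr_Rintegral mA iEpsi) _.
  apply: (@le_trans _ _ (\int[mu]_(y in A) (delta * `|psi y|))).
    apply: le_Rintegral => //; first exact: integrable_norm iEpsi.
      exact: integrable_scale.
    by move=> y Ay; rewrite normrM ler_wpM2r// Ed.
  by rewrite RintegralZl// ler_wpM2l.
have Fae : {ae mu, forall x, A x -> `|F x * psi x|%:E <= (delta * c * `|psi x|)%:E}%E.
  have : {ae mu, forall x (k : 'I_N.+1), A x ->
      (\int[mu]_(y in A) (K x y * phi k y)%:E)%E = (lam k * phi k x)%:E}.
    by apply: filter_forall => k; exact: eig.
  apply: filterS => x eigx Ax; rewrite lee_fin normrM ler_wpM2r// Fx// => k.
  exact: eigx.
(* This integral is the average of [lam 0, ..., lam N] with weights [a k ^+ 2], hence at least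
   [lam N]. *)
apply: (@le_trans _ _ (\int[mu]_(x in A) (F x * psi x))).
  rewrite Jbil -[leLHS]mulr1 -a1 mulr_sumr; apply: ler_sum => k _.
  by rewrite mulrAC -expr2 mulrC ler_wpM2l ?sqr_ge0// lamd// -ltnS.
apply: le_trans (ler_norm _) _.
rewrite -lee_fin EFin_normr_Rintegral//; last exact: (ibil (fun k => a k * lam k)).
apply: le_trans (le_abse_integral mu mA _) _.
  by apply/measurable_EFinP; exact: measurable_funM.
apply: (@le_trans _ _ (\int[mu]_(x in A) (delta * c * `|psi x|)%:E)%E).
  apply: ae_ge0_le_integral => //.
  - apply/measurable_EFinP; apply: measurableT_comp => //; exact: measurable_funM.
  - by move=> x _; rewrite lee_fin mulr_ge0// mulr_ge0.
  - by apply/measurable_EFinP; apply: measurable_funM => //; exact: measurableT_comp.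
have idc : mu.-integrable A (EFin \o (fun x => delta * c * `|psi x|)).
  exact: integrable_scale.
rewrite -[leLHS]fineK; last exact: integrable_fin_num.
rewrite lee_fin -[leLHS]/(\int[mu]_(x in A) (delta * c * `|psi x|)) RintegralZl//.
by rewrite -mulrA ler_wpM2l// expr2 ler_wpM2l.
Qed.

Lemma esum_le_natmul (R : realType) (S : set nat) (f : nat -> \bar R) (N : nat) (c : R) :
  S `<=` `I_N -> 0 <= c -> (forall i, S i -> (f i <= c%:E)%E) ->
  (\esum_(i in S) f i <= (N%:R * c)%:E)%E.
Proof.
move=> SN c0 fc; apply: ge_ereal_sup => _ [F [finF FS] <-].
apply: (@le_trans _ _ (\sum_(i \in F) c%:E)%E).
  by apply: lee_fsum => // i Fi; exact/fc/FS.
apply: (@le_trans _ _ (\sum_(i \in `I_N) c%:E)%E).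
  apply: lee_fsum_nneg_subset => //.
    by move=> i; rewrite !inE => /FS/SN.
by rewrite -(fsbig_ord _ _ (fun=> c%:E)) sumEFin sumr_const card_ord mulr_natl.
Qed.

(** * The Gaussian kernel on the cube with Lebesgue measure *)

Section Cube_measure.
Context {R : realType} {n : nat}.
Local Notation pt := (n.-tuple R).

Lemma measurable_cube : measurable (@cube R n).
Proof.
rewrite (_ : @cube R n = \bigcap_(i in [set: 'I_n])
    [set x : pt | tnth x i \in `[-1, 1]%R]); last first.
  apply/seteqP; split=> [x cx i _|x cx i]; first by rewrite /= in_itv /= cx.
  by have := cx i I; rewrite /= in_itv.
apply: fin_bigcap_measurable => // i _.
have := @measurable_tnth _ R n i measurableT _ (measurable_itv `[-1, 1]%R).
by rewrite setTI.
Qed.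

Lemma lebesgue_n_cube (mu : {measure set pt -> \bar R}) :
  lebesgue_n mu -> mu (@cube R n) = (2 ^+ n)%:E.
Proof.
move=> /(_ [tuple -1 | _ < n] [tuple 1 | _ < n]).
rewrite (_ : [set x | _] = @cube R n); last first.
  by apply/seteqP; split=> x cx i; have := cx i; rewrite !tnth_mktuple.
move=> ->; last by move=> i; rewrite !tnth_mktuple; lra.
under eq_bigr do rewrite !tnth_mktuple.
by rewrite prodr_const card_ord opprK.
Qed.

Lemma measurable_gaussK (sigma : R) (x : pt) : measurable_fun (@cube R n) (gaussK sigma x).
Proof.
apply: measurableT_comp; first exact: measurable_expR.
apply: measurable_funN; apply: measurable_funM => //.
apply: measurable_sum => i; apply: measurable_funX; apply: measurable_funB => //.
exact: measurable_funTS (measurable_tnth i).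
Qed.

Lemma measurable_feature (sigma : R) (a : 'I_n -> nat) :
  measurable_fun (@cube R n) (feature sigma a).
Proof.
apply: measurable_funM.
  apply: measurableT_comp; first exact: measurable_expR.
  apply: measurable_funN; apply: measurable_funM => //.
  apply: measurable_sum => i; apply: measurable_funX.
  exact: measurable_funTS (measurable_tnth i).
apply: measurable_prod => i _; apply: measurable_funM => //.
apply: measurable_funX; apply: measurable_funM => //.
exact: measurable_funTS (measurable_tnth i).
Qed.

(** The [D^n] features serve on both sides of the finite-rank kernel. Eigenvalues are numbered from
    0, so [lam (D ^ n)] is the first one after the rank is exhausted. *)
Lemma gaussK_eigenvalue_le (sigma : R) (mu : {measure set pt -> \bar R})
    (lam : nat -> R) (D : nat) (delta : R) :
  lebesgue_n mu -> eigenvalues_of_kernel mu (gaussK sigma) lam -> 0 <= delta ->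
  (forall x y : pt, cube x -> cube y ->
     `|gaussK sigma x y - trunc_gaussK sigma D x y| <= delta) ->
  lam (D ^ n)%N <= delta * ((1 + 2 ^+ n) / 2) ^+ 2.
Proof.
move=> mul [lamd [phi [mphi ortho eig _]]] d0 err.
pose I := {ffun 'I_n -> 'I_D}.
have <- : #|I| = (D ^ n)%N by rewrite card_ffun !card_ord.
pose u (l : 'I_#|I|) := feature sigma (fun i => enum_val l i).
apply: (@eigenvalue_finite_rank _ _ R mu (@cube R n) (2 ^+ n) delta (gaussK sigma) #|I| u u lam phi) => //.
- exact: measurable_cube.
- exact: lebesgue_n_cube.
- by move=> x _; exact: measurable_gaussK.
- by move=> l; exact: measurable_feature.
- by move=> l x _; exact: feature_le1.
- move=> x y cx cy.
  rewrite (_ : \sum_l _ = trunc_gaussK sigma D x y); first exact: err.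
  rewrite trunc_gaussKE.
  by rewrite (big_enum_val (fun a : I => feature sigma (fun i => a i) x * feature sigma (fun i => a i) y)).
Qed.

Lemma gaussK_degree (sigma A : R) : 0 < sigma -> 0 < A ->
  exists2 delta : R, 0 < delta & forall eps, 0 < eps < delta ->
  exists2 D, (0 < D)%N /\ D%:R <= 9 * (ln eps^-1 / ln (ln eps^-1)) &
  forall x y : pt, cube x -> cube y ->
    `|gaussK sigma x y - trunc_gaussK sigma D x y| <= eps ^+ 2 / A.
Proof.
move=> s0 A0; set B := 2 * sigma ^+ 2.
have B0 : 0 < B by rewrite mulr_gt0// exprn_gt0.
set c := n%:R * expR B ^+ n.
have c0 : 0 <= c by rewrite mulr_ge0// exprn_ge0// expR_ge0.
(* Using [c + 1] keeps the constant positive even when [n = 0] makes [c] vanish. *)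
have A'0 : 0 < A * (c + 1) by rewrite mulr_gt0//; lra.
have [delta delta0 deltaP] := exp_trunc_degree R _ _ A'0 B0.
exists delta => // eps /deltaP[D [Z [Z1 D0 Dle err]]]; exists D => // x y cx cy.
apply: le_trans (trunc_gaussK_err _ _ _ _ _ Z1 cx cy) _.
rewrite ler_pdivlMr// mulrC; apply: le_trans err.
have E0 : 0 <= expR (B * Z) / Z ^+ D.
  by rewrite divr_ge0 ?expR_ge0// exprn_ge0//; lra.
rewrite -[leRHS]mulrA ler_pM2l// -/B -/c ler_wpM2r//; lra.
Qed.

End Cube_measure.

(** * Asymptotic rates *)

Lemma le_rate (R : realType) (n D : nat) (eps c : R) :
  0 < ln eps^-1 -> 0 < ln (ln eps^-1) -> 0 <= c ->
  D%:R <= 9 * (ln eps^-1 / ln (ln eps^-1)) ->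
  (D ^ n)%:R * (c * ln eps^-1) <= c * 9 ^+ n * rate n eps.
Proof.
rewrite /rate; set L := ln eps^-1 => L0 lnL0 c0 DL.
rewrite natrX; apply: (@le_trans _ _ ((9 * (L / ln L)) ^+ n * (c * L))).
  rewrite ler_wpM2r ?mulr_ge0 ?(ltW L0)// lerXn2r ?nnegrE//.
  exact: le_trans DL.
by rewrite !exprMn exprVn exprSr le_eqVlt; apply/orP; left; apply/eqP; ring.
Qed.

Lemma ln_inv_gt (R : realType) (c eps : R) : 0 < eps < expR (- c) -> c < ln eps^-1.
Proof.
move=> /andP[e0]; rewrite lnV ?posrE// -{1}(lnK (x := eps)) ?posrE// ltr_expR; lra.
Qed.

(** As [theta < 1/2], both thresholds are at least [eps / 2 >= lam (D ^ n)], so both sums have at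
    most [D^n] terms. Each entropy term is at most [ln l0 + L]. *)
Lemma eig_entropy_rate (R : realType) (n : nat) (sigma : R)
    (mu : {measure set (n.-tuple R) -> \bar R}) (lam : nat -> R) (theta : R) :
  0 < sigma -> lebesgue_n mu -> eigenvalues_of_kernel mu (gaussK sigma) lam ->
  0 < theta < 2^-1 ->
  exists C : R, exists2 delta : R, 0 < delta &
    forall eps : R, 0 < eps < delta ->
      (eig_entropy eps lam + eig_count ((1 - theta) * eps) lam * (ln (3 / theta))%:E
         <= (C * rate n eps)%:E)%E.
Proof.
move=> s0 mul eigs /andP[th0 th1].
have lamd : {homo lam : i j / (i <= j)%N >-> j <= i} by case: eigs.
set c := ((1 + 2 ^+ n) / 2) ^+ 2 : R.
have c0 : 0 <= c by exact: sqr_ge0.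
(* With this constant the eigenvalue bound is [eps^2 c / (2c + 1) <= eps / 2] for [eps < 1]. *)
have A0 : 0 < 2 * c + 1 by lra.
have [d1 d10 d1P] := @gaussK_degree R n sigma _ s0 A0.
set l0 := Num.max (lam 0) 1.
have l01 : 1 <= l0 by rewrite le_max lexx orbT.
have lnl0 : 0 <= ln l0 by exact: ln_ge0.
set t := ln (3 / theta).
have t0 : 0 <= t by apply: ln_ge0; rewrite ler_pdivlMr//; lra.
(* The threshold yields [ln l0 + t < L], so each of the [D^n] indices contributes at most [2 L]. *)
exists (2 * 9 ^+ n), (Num.min d1 (expR (- (1 + ln l0 + t)))).
  by rewrite lt_min d10 expR_gt0.
move=> eps; rewrite lt_min => /and3P[e0 ed1 ed2].
have Lgt : 1 + ln l0 + t < ln eps^-1 by apply: ln_inv_gt; rewrite e0.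
have lnL0 : 0 < ln (ln eps^-1) by apply: ln_gt0; lra.
have e1 : eps < 1.
  by apply: lt_le_trans ed2 _; rewrite -[leRHS]expR0 ler_expR; lra.
have [D [D0 DL] err] := d1P eps (introT andP (conj e0 ed1)).
have lamN : lam (D ^ n)%N <= eps / 2.
  have del0 : 0 <= eps ^+ 2 / (2 * c + 1) by rewrite divr_ge0 ?sqr_ge0 ?(ltW A0).
  apply: le_trans (gaussK_eigenvalue_le sigma mu lam D _ mul eigs del0 err) _.
  have ce (k : R) : 0 <= k -> eps ^+ 2 * k <= eps / 2 * (2 * k + 1).
    move=> k0; have : eps ^+ 2 * k <= eps * k.
      by rewrite ler_wpM2r// expr2 ler_piMr ?(ltW e0)// ltW.
    lra.
  by rewrite -/c mulrAC ler_pdivrMr//; exact: ce.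
have sub e : eps / 2 <= e -> [set i | e < lam i] `<=` `I_(D ^ n).
  move=> ee i /= ei; rewrite ltnNge; apply/negP => /lamd li; lra.
have h1 : (eig_entropy eps lam <= ((D ^ n)%:R * (ln l0 + ln eps^-1))%:E)%E.
  apply: esum_le_natmul => [||i /= ei]; [by apply: sub; lra|lra|].
  rewrite lee_fin -lnM ?posrE ?invr_gt0//; last by lra.
  rewrite ler_ln ?posrE ?divr_gt0//; try lra.
  by rewrite ler_wpM2r ?invr_ge0 ?(ltW e0)// (le_trans (lamd 0%N i _))// le_max lexx.
have h2 : (eig_count ((1 - theta) * eps) lam <= ((D ^ n)%:R * 1)%:E)%E.
  by apply: esum_le_natmul => //; apply: sub; nra.
apply: (@le_trans _ _ (((D ^ n)%:R * (ln l0 + ln eps^-1))%:E + ((D ^ n)%:R * 1)%:E * t%:E)%E).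
  by apply: leeD => //; apply: lee_wpmul2r => //; rewrite lee_fin.
rewrite -EFinM -EFinD lee_fin.
apply: (@le_trans _ _ ((D ^ n)%:R * (2 * ln eps^-1))).
  rewrite mulr1 -mulrDr ler_wpM2l//; lra.
by apply: le_rate => //; lra.
Qed.

Lemma metric_entropy_rate (R : realType) (n : nat) (sigma : R) :
  0 < sigma ->
  exists C : R, exists2 delta : R, 0 < delta &
    forall eps : R, 0 < eps < delta ->
      (metric_entropy (rkhs_open_ball (@gaussK R n sigma)) eps <= (C * rate n eps)%:E)%E.
Proof.
move=> s0.
have A0 : 0 < 16 :> R by lra.
have [d1 d10 d1P] := @gaussK_degree R n sigma _ s0 A0.
(* The threshold gives [ln L >= 1], hence [ln D <= D <= 9 L]. The logarithm of the number of grid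
   values is then at most [ln 10 + n ln D + L <= (9 n + 11) L]. *)
exists ((9 * n%:R + 11) * 9 ^+ n), (Num.min d1 (expR (- expR 1))).
  by rewrite lt_min d10 expR_gt0.
move=> eps; rewrite lt_min => /and3P[e0 ed1 ed2].
set L := ln eps^-1.
have Lgt : expR 1 < L by apply: ln_inv_gt; rewrite e0.
have e2 : 2 <= expR 1 :> R by have := expR_ge1Dx (1 : R); lra.
have L0 : 0 < L by lra.
have lnL1 : 1 <= ln L by rewrite -[leLHS]expRK ler_ln ?posrE ?expR_gt0 ?(ltW Lgt).
have e1 : eps < 1.
  by apply: lt_le_trans ed2 _; rewrite -[leRHS]expR0 ler_expR oppr_le0 expR_ge0.
have [D [D0 DL] err] := d1P eps (introT andP (conj e0 ed1)).
have Dn0 : 0 < (D ^ n)%:R :> R by rewrite ltr0n expn_gt0 D0.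
have Dn1 : 1 <= (D ^ n)%:R :> R by rewrite ler1n expn_gt0 D0.
(* The mesh parameter is [M = truncn x + 1 >= x]; its grid has [M + 1] points, whence the [.+2]
   below. *)
set x := 8 * (D ^ n)%:R / eps.
have x0 : 0 <= x by rewrite divr_ge0 ?mulr_ge0// ltW.
have /andP[tx1 tx2] := truncn_itv x0.
have cov : Defs.covered_by (rkhs_open_ball (@gaussK R n sigma)) eps
    ((Num.truncn x).+2 ^ (D ^ n)).
  apply: rkhs_ball_covered => //.
  - by move=> y cy; apply: le_trans (ler_norm _) (err y y cy cy).
  - by rewrite -ler_pdivrMr// ltW.
apply: (@le_trans _ _ (ln ((Num.truncn x).+2 ^ (D ^ n))%:R)%:E).
  by apply: ereal_inf_lbound; exists ((Num.truncn x).+2 ^ (D ^ n))%N.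
rewrite lee_fin natrX lnXn ?ltr0n// -[leLHS]mulr_natl.
apply: (@le_trans _ _ ((D ^ n)%:R * ((9 * n%:R + 11) * L))); last first.
  by apply: le_rate => //; lra.
rewrite ler_wpM2l ?(ltW Dn0)//.
have DR0 : 0 < D%:R :> R by rewrite ltr0n.
have xle : (Num.truncn x).+2%:R <= 10 * (D ^ n)%:R / eps.
  rewrite -[(Num.truncn x).+2]addn2 natrD.
  have : 2 <= 2 * (D ^ n)%:R / eps by rewrite ler_pdivlMr//; nra.
  by move: tx1; rewrite /x; lra.
apply: (@le_trans _ _ (ln (10 * (D ^ n)%:R / eps))).
  by rewrite ler_ln ?posrE ?ltr0n// divr_gt0// mulr_gt0.
rewrite lnM ?posrE ?invr_gt0 ?mulr_gt0// lnM ?posrE// natrX lnXn// -/L -[ln D%:R *+ n]mulr_natl.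
have ln10 : ln 10 < 10 :> R by apply: ln_sublinear; lra.
have lnD : ln D%:R <= 9 * L.
  apply: le_trans (ltW (ln_sublinear _)) _ => //.
  apply: le_trans DL _; rewrite ler_pM2l// ler_pdivrMr; last by lra.
  by rewrite ler_peMr// ltW.
have : n%:R * ln D%:R <= n%:R * (9 * L) by rewrite ler_wpM2l.
by lra.
Qed.

Theorem theorem6 (R : realType) (n : nat) (sigma : R)
    (mu : {measure set (n.-tuple R) -> \bar R}) (lam : nat -> R) :
  (0 < n)%N -> 0 < sigma ->
  lebesgue_n mu ->
  eigenvalues_of_kernel mu (gaussK sigma) lam ->
  (forall theta : R, 0 < theta < 2^-1 ->
     exists C : R, exists2 delta : R, 0 < delta &
       forall eps : R, 0 < eps < delta ->
         (eig_entropy eps lam + eig_count ((1 - theta) * eps) lam * (ln (3 / theta))%:E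
            <= (C * rate n eps)%:E)%E)
  /\
  (exists C : R, exists2 delta : R, 0 < delta &
     forall eps : R, 0 < eps < delta ->
       (metric_entropy (rkhs_open_ball (@gaussK R n sigma)) eps <= (C * rate n eps)%:E)%E).
Proof.
move=> _ s0 mul eigs; split; last exact: metric_entropy_rate.
by move=> theta; exact: eig_entropy_rate s0 mul eigs.
Qed.
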